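(* Let $\mathbb F$ be an infinite field and let $\mathcal X$ be the fundamental pattern of some matroid $M$. Then $M$ is representable over $\mathbb F$ if and only if $\operatorname{mr}\mathcal Q_{\mathbb F}(\mathcal X)=\operatorname{tri}(\mathcal X)$.
   Context: The fundamental pattern of a matroid $M$ is the $\{0,*\}$-matrix with one row for each hyperplane of $M$ and one column for each element of $E(M)$, whose entry in row $H$, column $e$ is $0$ if and only if $e\in H$. For a pattern $\mathcal X$ and field $\mathbb F$, $\mathcal Q_{\mathbb F}(\mathcal X)$ is the set of matrices over $\mathbb F$ whose entries are nonzero exactly in the positions where $\mathcal X$ has $*$, and $\operatorname{mr}\mathcal Q_{\mathbb F}(\mathcal X)$ is the smallest rank of such a matrix. A square pattern is a triangle if its rows and columns can be permuted independently to give a lower triangular pattern with all diagonal entries $*$; $\operatorname{tri}(\mathcal X)$ is the largest $k$ such that some $k\times k$ submatrix of $\mathcal X$ is a triangle. *)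

(* Defs.v *)
From HB Require Import structures.
From mathcomp Require Import all_boot all_order all_fingroup all_algebra.
From mathcomp Require Import boolp.

Set Implicit Arguments.
Unset Strict Implicit.
Unset Printing Implicit Defensive.

Import GRing.Theory.

Local Open Scope ring_scope.

(* Finite matroids whose ground set E(M) is the whole finite type E. *)
Record matroid (E : finType) := Matroid {
  indep : pred {set E};
  indep_set0 : indep set0;
  indep_subset : forall I J : {set E}, J \subset I -> indep I -> indep J;
  indep_augment : forall I J : {set E}, indep I -> indep J -> (#|I| < #|J|)%N ->
    exists2 e, e \in J :\: I & indep (e |: I)
}.

Section MatroidNotions.
Variables (E : finType) (M : matroid E).
Implicit Types A H : {set E}.

Definition rk A : nat := \max_(I : {set E} | (I \subset A) && indep M I) #|I|.

Definition cl A : {set E} := [set e | rk (e |: A) == rk A].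

Definition flat A : bool := cl A == A.

(* A flat of rank r(M) - 1; the successor form leaves a matroid of rank 0
   without hyperplanes, as it should be. *)
Definition hyperplane H : bool := flat H && ((rk H).+1 == rk [set: E]).

Definition hyperplanes : {set {set E}} := [set H | hyperplane H].

(* M is the vector matroid of a matrix A over F whose columns are labelled by E.
   The columns form a family: two equal columns are dependent. *)
Definition representable (F : fieldType) : Prop :=
  exists (d : nat) (A : 'M[F]_(d, #|E|)),
    forall S : {set E}, indep M S <-> free [seq col (enum_rank e) A | e in S].

End MatroidNotions.

(* A {0,*}-matrix is a boolean matrix in which true stands for *. *)
Definition pattern (m n : nat) := 'M[bool]_(m, n).

Definition fundamental_pattern (E : finType) (M : matroid E) :
    pattern #|hyperplanes M| #|E| :=
  \matrix_(i, j) (enum_val j \notin (enum_val i : {set E})).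

Section PatternParameters.
Variables (m n : nat).
Implicit Types X : pattern m n.

Definition in_Q (F : fieldType) X (A : 'M[F]_(m, n)) : Prop :=
  forall i j, A i j != 0 <-> X i j.

Definition attained_rank (F : fieldType) X : pred nat :=
  fun r => `[< exists2 A : 'M[F]_(m, n), in_Q X A & \rank A = r >].

Lemma attained_rank_ex (F : fieldType) X : exists r, attained_rank F X r.
Proof.
pose A : 'M[F]_(m, n) := \matrix_(i, j) (X i j)%:R.
exists (\rank A); apply/asboolP; exists A => // i j.
by rewrite mxE; case: (X i j); rewrite ?oner_eq0 ?eqxx.
Qed.

Definition mr (F : fieldType) X : nat := ex_minn (attained_rank_ex F X).

Definition triangle k (T : pattern k k) : bool :=
  [exists s : 'S_k, exists t : 'S_k,
    let L := row_perm s (col_perm t T) in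
    [forall i, L i i] && [forall i : 'I_k, forall j : 'I_k, (i < j)%N ==> ~~ L i j]].

Definition increasing k l (f : {ffun 'I_k -> 'I_l}) : bool :=
  [forall i : 'I_k, forall j : 'I_k, (i < j)%N ==> (f i < f j)%N].

Definition has_triangle X (k : nat) : bool :=
  [exists f : {ffun 'I_k -> 'I_m}, exists g : {ffun 'I_k -> 'I_n},
    [&& increasing f, increasing g & triangle (mxsub f g X)]].

(* A k x k submatrix has k <= minn m n, and the empty one is a triangle. *)
Definition tri X : nat := \max_(k < (minn m n).+1 | has_triangle X k) k.

End PatternParameters.

(* Main.v *)
Require Import Defs.
From mathcomp Require Import all_boot all_order all_fingroup all_algebra.
From mathcomp Require Import boolp.

(** Both [mr] and [tri] of the fundamental pattern are compared with the rank r
    of M.  Always [tri <= mr], since a triangular matrix with nonzero diagonal is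
    invertible.  For the fundamental pattern [tri] equals r: if B is a basis, the
    hyperplanes cl(B \ b) cut out an r x r diagonal pattern, and conversely the
    columns of a triangle are independent in M.  So the claim is that M is
    representable exactly when some matrix with this pattern has rank r.  From a
    representation, pick for each hyperplane a linear form that vanishes exactly
    on it; evaluating these forms on the representing vectors gives such a matrix.
    Conversely, the columns of a matrix of rank r with this pattern represent M:
    reading a linear relation in the rows cl(B \ b) isolates its coefficients. *)

Set Implicit Arguments.
Unset Strict Implicit.
Unset Printing Implicit Defensive.

Import GRing.Theory.
Local Open Scope ring_scope.

(** * Rank, closure and hyperplanes of a matroid *)

Section MatroidTheory.
Variables (E : finType) (M : matroid E).
Implicit Types (A B H I J S : {set E}) (e b : E).
Local Notation r := (rk M [set: E]).

Lemma leq_rk_indep I A : I \subset A -> indep M I -> (#|I| <= rk M A)%N.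
Proof. by move=> sIA iI; rewrite /rk (bigD1 I) ?sIA //= leq_maxl. Qed.

Lemma rk_attained A : exists I, [/\ I \subset A, indep M I & #|I| = rk M A].
Proof.
pose P I := (I \subset A) && indep M I.
have P0 : (0 < #|P|)%N.
  by apply/card_gt0P; exists set0; rewrite unfold_in /P sub0set indep_set0.
have [I /andP[sIA iI] rI] := eq_bigmax_cond (fun I : {set E} => #|I|) P0.
by exists I; split=> //; rewrite /rk -rI; apply: eq_bigl.
Qed.

Lemma rkS A B : A \subset B -> (rk M A <= rk M B)%N.
Proof.
move=> sAB; have [I [sIA iI <-]] := rk_attained A.
exact: leq_rk_indep (subset_trans sIA sAB) iI.
Qed.

Lemma indep_extend I A : indep M I -> I \subset A ->
  exists J, [/\ I \subset J, J \subset A, indep M J & #|J| = rk M A].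
Proof.
move: {2}(rk M A - #|I|)%N (leqnn (rk M A - #|I|)) => n.
elim: n I => [|n IHn] I ltn iI sIA.
  exists I; split=> //; apply/eqP.
  by rewrite eqn_leq leq_rk_indep //= -subn_eq0 -leqn0.
case: (ltnP #|I| (rk M A)) => [lt_I|ge_I]; last first.
  by exists I; split=> //; apply/eqP; rewrite eqn_leq leq_rk_indep.
have [K [sKA iK cK]] := rk_attained A.
have [|e /setDP[eK eI] iIe] := indep_augment iI iK; first by rewrite cK.
have [||J [sJ sJA iJ cJ]] := IHn (e |: I) _ iIe.
- by rewrite cardsU1 eI add1n subnS -ltnS prednK ?subn_gt0 // (leq_trans _ ltn).
- by rewrite subUset sub1set (subsetP sKA).
by exists J; split=> //; apply: subset_trans sJ; apply: subsetUr.
Qed.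

Lemma sub_cl A : A \subset cl M A.
Proof. by apply/subsetP=> e eA; rewrite inE (setUidPr _) ?sub1set. Qed.

Lemma notin_clE e A : (e \notin cl M A) = (rk M A < rk M (e |: A))%N.
Proof. by rewrite inE ltn_neqAle rkS ?subsetUr // andbT eq_sym. Qed.

Lemma sub_cl_maximal I A : I \subset A -> indep M I -> #|I| = rk M A ->
  A \subset cl M I.
Proof.
move=> sIA iI cI; apply/subsetP => e eA.
rewrite inE eqn_leq (rkS (subsetUr _ _)) andbT.
apply: leq_trans (_ : rk M A <= _)%N; first by rewrite rkS // subUset sub1set eA.
by rewrite -cI leq_rk_indep.
Qed.

Lemma notin_cl_indep I e : indep M I -> e \notin cl M I -> indep M (e |: I).
Proof.
move=> iI; rewrite notin_clE => lt.
have [K [sK iK cK]] := rk_attained (e |: I).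
have [|f /setDP[fK fI] iIf] := indep_augment iI iK.
  by rewrite cK; apply: leq_trans lt; rewrite ltnS leq_rk_indep.
by move/(subsetP sK): fK; rewrite !inE (negbTE fI) orbF => /eqP <-.
Qed.

Lemma indep_notin_cl I A e : I \subset A -> #|I| = rk M A ->
  e \notin A -> indep M (e |: I) -> e \notin cl M A.
Proof.
move=> sIA cI eA iIe; rewrite notin_clE -cI.
have eI : e \notin I by apply: contra eA; apply: (subsetP sIA).
by have := leq_rk_indep (setUS [set e] sIA) iIe; rewrite cardsU1 eI.
Qed.

(** Otherwise a maximum independent subset of [A] could be augmented by some [e] in [cl M A].
    Maximality puts [e] outside [A], and adding [e] to [A] would then raise the rank. *)
Lemma rk_cl A : rk M (cl M A) = rk M A.
Proof.
apply/eqP; rewrite eqn_leq (rkS (sub_cl A)) andbT leqNgt; apply/negP => lt.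
have [I [sIA iI cI]] := rk_attained A.
have [J [sJ iJ cJ]] := rk_attained (cl M A).
have [|e /setDP[eJ eI] iIe] := indep_augment iI iJ; first by rewrite cI cJ.
have eA : e \notin A.
  apply/negP => eA; have := @leq_rk_indep (e |: I) A.
  by rewrite subUset sub1set eA sIA cardsU1 eI cI ltnn => /(_ isT iIe).
by have := indep_notin_cl sIA cI eA iIe; rewrite (subsetP sJ).
Qed.

Lemma cl_flat A : flat M (cl M A).
Proof.
rewrite /flat eqEsubset sub_cl andbT; apply/subsetP => e.
apply: contraLR; rewrite !notin_clE rk_cl => /leq_trans; apply.
exact/rkS/setUS/sub_cl.
Qed.

(** For [e] outside [cl M B], extend a maximum independent subset [I] of [A] to a maximum one [J] of
    [B]. Then [e |: J] is independent, hence so is [e |: I], which keeps [e] out of [cl M A]. *)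
Lemma clS A B : A \subset B -> cl M A \subset cl M B.
Proof.
move=> sAB; apply/subsetP => e; apply: contraLR => eB.
have [I [sIA iI cI]] := rk_attained A.
have [J [sIJ sJB iJ cJ]] := indep_extend iI (subset_trans sIA sAB).
have eNB : e \notin B by apply: contra eB; apply: (subsetP (sub_cl B)).
apply: (indep_notin_cl sIA cI); first by apply: contra eNB; apply: (subsetP sAB).
apply: indep_subset (setUS [set e] sIJ) _; apply: notin_cl_indep => //.
move: eB; rewrite !notin_clE -{1}cJ => lt.
apply: leq_ltn_trans (_ : #|J| < _)%N.
  by have [K [sKJ iK <-]] := rk_attained J; apply: subset_leq_card.
(* Augmenting [J] from a maximum independent subset of [e |: B] can only add [e], since [J] is
   already maximum in [B]. *)
have [K [sK iK cK]] := rk_attained (e |: B).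
have [|f /setDP[fK fJ] iJf] := indep_augment iJ iK; first by rewrite cK.
have ef : f = e.
  move/(subsetP sK): fK; rewrite inE => /orP[/set1P //|fB].
  have := @leq_rk_indep (f |: J) B.
  by rewrite subUset sub1set fB sJB cardsU1 fJ cJ ltnn => /(_ isT iJf).
by have := leq_rk_indep (subxx (f |: J)) iJf; rewrite cardsU1 fJ ef.
Qed.

Lemma sub_hyperplane_cl H A : hyperplane M H -> A \subset H -> cl M A \subset H.
Proof. by case/andP=> /eqP clH _ /clS; rewrite clH. Qed.

Lemma rk_indep I : indep M I -> rk M I = #|I|.
Proof.
move=> iI; apply/eqP; rewrite eqn_leq leq_rk_indep // andbT.
by have [K [sKI _ <-]] := rk_attained I; apply: subset_leq_card.
Qed.

Section Basis.
Variable B : {set E}.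
Hypotheses (iB : indep M B) (cB : #|B| = r).

Definition basis_hyperplane b := cl M (B :\ b).

Lemma basis_hyperplaneP b : b \in B -> hyperplane M (basis_hyperplane b).
Proof.
move=> bB; rewrite /hyperplane cl_flat rk_cl rk_indep.
  by rewrite -cB (cardsD1 b B) bB add1n eqxx.
exact: indep_subset (subD1set B b) iB.
Qed.

Lemma mem_basis_hyperplane b e : b \in B -> e \in B ->
  (e \in basis_hyperplane b) = (e != b).
Proof.
move=> bB eB; have [->|neb] /= := eqVneq e b; last first.
  by apply: (subsetP (sub_cl _)); rewrite !inE neb.
apply/negbTE/(@indep_notin_cl (B :\ b)); rewrite ?setD11 ?setD1K //.
by rewrite rk_indep // (indep_subset (subD1set B b)).
Qed.

End Basis.
End MatroidTheory.

(** * Triangles in a pattern and the rank of its matrices *)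

Section Triangles.
Variables m n : nat.
Implicit Types X : pattern m n.

(** Here [s i] counts the indices with a smaller value of [f], which is the position of [f i] after
    sorting. This turns an injective choice of rows or columns into the increasing one that
    [has_triangle] asks for. *)
Lemma injective_increasing_perm k l (f : 'I_k -> 'I_l) : injective f ->
  exists g : {ffun 'I_k -> 'I_l}, increasing g /\
    exists s : 'S_k, forall i, f i = g (s i).
Proof.
move=> f_inj; pose below i := [set j | f j < f i]%N.
have below_lt i : (#|below i| < k)%N.
  rewrite -[X in (_ < X)%N]card_ord -cardsT; apply: proper_card.
  by rewrite properT; apply/eqP => /setP/(_ i); rewrite !inE ltnn.
have below_mono i j : (f i < f j)%N -> (#|below i| < #|below j|)%N.
  move=> lt_ij; apply/proper_card/properP; split.
    by apply/subsetP=> x; rewrite !inE => /ltn_trans; apply.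
  by exists i; rewrite !inE ?ltnn.
pose s0 i := Ordinal (below_lt i).
have s0_inj : injective s0.
  move=> i j /(congr1 val) /= eq_ij; apply: f_inj; apply: val_inj.
  by case: (ltngtP (f i) (f j)) => // /below_mono; rewrite eq_ij ltnn.
pose s := perm s0_inj.
exists [ffun i => f ((s^-1)%g i)]; split; last first.
  by exists s => i; rewrite ffunE permK.
apply/forallP=> i; apply/forallP=> j; apply/implyP; rewrite !ffunE.
rewrite -{1}(permKV s i) -{1}(permKV s j).
move: ((s^-1)%g i) ((s^-1)%g j) => {}i {}j; rewrite !permE /=; apply: contraTltn.
rewrite leq_eqVlt -leqNgt => /orP[/eqP/val_inj/f_inj-> //|/below_mono].
exact: ltnW.
Qed.

(** Lets a triangle be given by rows and columns listed directly in triangular order, in place of an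
    increasing selection followed by two permutations. *)
Lemma has_triangleP X k : reflect
  (exists f : 'I_k -> 'I_m, exists g : 'I_k -> 'I_n,
     (forall i, X (f i) (g i)) /\ (forall i j : 'I_k, (i < j)%N -> ~~ X (f i) (g j)))
  (has_triangle X k).
Proof.
apply: (iffP existsP) => [[f /existsP[g /and3P[_ _ /existsP[s /existsP[t]]]]]|].
  move=> /andP[/forallP d /forallP u].
  exists (f \o s), (g \o t); split=> [i|i j ltij].
    by have := d i; rewrite !mxE.
  by have /forallP/(_ j) := u i; rewrite ltij !mxE.
move=> [f [g [d u]]].
(* A row repeated at positions [i < j] would have in column [g j] both a 0, above the diagonal, and
   a star, on it. A repeated column fails in the same way in row [f i]. *)
have f_inj : injective f.
  move=> i j eq_f; apply: val_inj; case: (ltngtP i j) => // /u.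
    by rewrite eq_f d.
  by rewrite -eq_f d.
have g_inj : injective g.
  move=> i j eq_g; apply: val_inj; case: (ltngtP i j) => // /u.
    by rewrite -eq_g d.
  by rewrite eq_g d.
have [f' [incf [s fs]]] := injective_increasing_perm f_inj.
have [g' [incg [t gt]]] := injective_increasing_perm g_inj.
exists f'; apply/existsP; exists g'; rewrite incf incg /=.
apply/existsP; exists s; apply/existsP; exists t; apply/andP; split.
  by apply/forallP=> i; rewrite !mxE -fs -gt.
apply/forallP=> i; apply/forallP=> j; apply/implyP=> ltij.
by rewrite !mxE -fs -gt u.
Qed.

Lemma has_triangle_rank (F : fieldType) X (A : 'M[F]_(m, n)) k :
  in_Q X A -> has_triangle X k -> (k <= \rank A)%N.
Proof.
move=> QA /has_triangleP[f [g [d u]]].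
have uT : mxsub f g A \in unitmx.
  rewrite unitmxE det_trig; last first.
    apply/is_trig_mxP=> i j /u; rewrite mxE => XN.
    by apply: contraNeq XN => /QA.
  by rewrite unitfE; apply/prodf_neq0 => i _; rewrite mxE; apply/QA.
(* The rank factorization of [A] makes the invertible submatrix factor through dimension
   [\rank A]. *)
rewrite -(mxrank_unit uT) -{1}(mulmx_base A) mxsub_mul.
exact: mulmx_max_rank.
Qed.

Lemma has_triangle_le_tri X k : has_triangle X k -> (k <= tri X)%N.
Proof.
move=> tk; have /existsP[f /existsP[g /and3P[incf incg _]]] := tk.
have leq_inc l (h : {ffun 'I_k -> 'I_l}) : increasing h -> (k <= l)%N.
  move=> /forallP inch; suff /leq_card: injective h by rewrite !card_ord.
  move=> i j eqh; apply: val_inj; case: (ltngtP i j) => // lt.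
    by have /forallP/(_ j) := inch i; rewrite lt eqh ltnn.
  by have /forallP/(_ i) := inch j; rewrite lt eqh ltnn.
have lek : (k < (minn m n).+1)%N by rewrite ltnS leq_min (leq_inc _ f) ?(leq_inc _ g).
exact: (@leq_bigmax_cond _ (fun k : 'I_(minn m n).+1 => has_triangle X k)
  (fun k => nat_of_ord k) (Ordinal lek)).
Qed.

Lemma tri_le_rank (F : fieldType) X (A : 'M[F]_(m, n)) :
  in_Q X A -> (tri X <= \rank A)%N.
Proof. by move=> QA; apply/bigmax_leqP=> k; apply: has_triangle_rank. Qed.

Lemma mr_attained (F : fieldType) X :
  exists2 A : 'M[F]_(m, n), in_Q X A & \rank A = mr F X.
Proof. by rewrite /mr; case: ex_minnP => r /asboolP[A QA rA] _; exists A. Qed.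

Lemma mr_le_rank (F : fieldType) X (A : 'M[F]_(m, n)) :
  in_Q X A -> (mr F X <= \rank A)%N.
Proof.
rewrite /mr; case: ex_minnP => r _ min_r QA; apply: min_r.
by apply/asboolP; exists A.
Qed.

End Triangles.

(** * Freeness and spans of finite families of vectors *)

Section FamiliesOfVectors.
Variables (F : fieldType) (vT : vectType F) (T : finType) (f : T -> vT).
Implicit Types (S I : {set T}) (c : T -> F).

Lemma sum_enum_val S (k : 'I_#|S| -> F) :
  exists c, (forall i, c (enum_val i) = k i) /\
    \sum_i k i *: f (enum_val i) = \sum_(x in S) c x *: f x.
Proof.
(* At most one term: [k] at the position of [x] in [S], and 0 outside [S]. *)
pose c x := \sum_(i : 'I_#|S| | enum_val i == x) k i.
have ck i : c (enum_val i) = k i.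
  by apply: big_pred1 => j; apply: (inj_eq enum_val_inj).
exists c; split=> //; rewrite [RHS]big_enum_val.
by apply: eq_bigr => i _; rewrite ck.
Qed.

Lemma sum_image_tuple S (k : 'I_#|S| -> F) :
  \sum_i k i *: (image_tuple f S)`_i = \sum_i k i *: f (enum_val i).
Proof. by apply: eq_bigr => i _; rewrite nth_image. Qed.

Lemma free_imageP S : reflect
  (forall c, \sum_(x in S) c x *: f x = 0 -> forall x, x \in S -> c x = 0)
  (free [seq f x | x in S]).
Proof.
apply: (iffP (@freeP _ _ _ (image_tuple f S))) => [h c c0 x xS|h k].
  have := h (fun i => c (enum_val i)).
  rewrite sum_image_tuple -(big_enum_val (fun x => c x *: f x)) c0.
  move=> /(_ erefl (enum_rank_in xS x)).
  by rewrite enum_rankK_in.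
rewrite sum_image_tuple.
have [c [ck ->]] := sum_enum_val k => /h c0 i.
by rewrite -ck c0 // enum_valP.
Qed.

Lemma span_imageP S w : w \in <<[seq f x | x in S]>>%VS ->
  exists c, w = \sum_(x in S) c x *: f x.
Proof.
move/(@coord_span _ _ _ (image_tuple f S)).
rewrite sum_image_tuple.
have [c [_ ->]] := sum_enum_val (fun i => coord (image_tuple f S) i w).
by exists c.
Qed.

Lemma sum_span_image S c : \sum_(x in S) c x *: f x \in <<[seq f x | x in S]>>%VS.
Proof.
by apply: memv_suml => x xS; apply/memvZ/memv_span/image_f.
Qed.

Lemma free_imageU1 S x : x \notin S ->
  free [seq f y | y in x |: S] =
    (f x \notin <<[seq f y | y in S]>>%VS) && free [seq f y | y in S].
Proof.
move=> xS; rewrite -free_cons -[_ :: _]/(map f (x :: enum S)).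
apply: perm_free; apply: perm_map; apply: uniq_perm.
- exact: enum_uniq.
- by rewrite /= mem_enum xS enum_uniq.
by move=> y; rewrite !(inE, mem_enum).
Qed.

Lemma free_imageS I S : I \subset S ->
  free [seq f x | x in S] -> free [seq f x | x in I].
Proof.
move=> sIS /free_imageP fS; apply/free_imageP => c c0 x xI.
(* A relation on [I] is extended by zero to [S]. *)
have := fS (fun x => if x \in I then c x else 0) _ x (subsetP sIS x xI).
rewrite xI; apply; rewrite -[RHS]c0 [RHS]big_mkcond (big_setID I) /=.
rewrite [X in _ + X]big1 ?addr0; last first.
  by move=> y /setDP[_ /negbTE->]; rewrite scale0r.
rewrite (setIidPr sIS) big_mkcond; by apply: eq_bigr => y _; case: (y \in I).
Qed.

End FamiliesOfVectors.

(** The map [\1 - projv V] kills [V] but not [w], so one of its coordinates in a basis of the whole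
    space is the required form. *)
Lemma separating_form (F : fieldType) (vT : vectType F) (V : {vspace vT}) w :
  w \notin V ->
  exists phi : {scalar vT}, (forall x, x \in V -> phi x = 0) /\ phi w != 0.
Proof.
move=> wV; have pw0 : (\1 - projv V)%VF w != 0.
  apply: contra wV; rewrite !lfunE /= !lfunE /= subr_eq0 => /eqP->.
  exact: memv_proj.
have [i ci] : exists i, coord (vbasis {:vT}) i ((\1 - projv V)%VF w) != 0.
  apply/existsP; apply: contraNT pw0; rewrite negb_exists => /forallP c0.
  rewrite (coord_vbasis (memvf ((\1 - projv V)%VF w))) big1 // => i _.
  by have := c0 i; rewrite negbK => /eqP->; rewrite scale0r.
exists (coord (vbasis {:vT}) i \o (\1 - projv V)%VF); split=> [x xV|//].
by rewrite /= !lfunE /= !lfunE /= projv_id // subrr linear0.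
Qed.

(** * The fundamental pattern: its triangle number, and its matrices of rank at most r *)

Section FundamentalPattern.
Variables (E : finType) (M : matroid E).
Local Notation r := (rk M [set: E]).
Local Notation X := (fundamental_pattern M).
Implicit Types (A B H I S : {set E}) (e b : E).

Lemma fundamental_patternE (i : 'I_#|hyperplanes M|) e :
  X i (enum_rank e) = (e \notin (enum_val i : {set E})).
Proof. by rewrite mxE enum_rankK. Qed.

Lemma hyperplane_row H : hyperplane M H ->
  exists i : 'I_#|hyperplanes M|, enum_val i = H.
Proof.
move=> hH; have HM : H \in hyperplanes M by rewrite inE.
by exists (enum_rank_in HM H); rewrite enum_rankK_in.
Qed.

Lemma basis_rows B : indep M B -> #|B| = r -> forall b, b \in B ->
  exists i : 'I_#|hyperplanes M|, enum_val i = basis_hyperplane M B b.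
Proof. by move=> iB cB b bB; apply/hyperplane_row/basis_hyperplaneP. Qed.

Lemma rk_le_tri : (r <= tri X)%N.
Proof.
have [B [_ iB cB]] := rk_attained M [set: E].
rewrite -cB; apply/has_triangle_le_tri/has_triangleP.
have /boolp.choice[f fE] (j : 'I_#|B|) :
    exists i : 'I_#|hyperplanes M|,
      enum_val i = basis_hyperplane M B (enum_val j).
  by apply: basis_rows => //; apply: enum_valP.
exists f, (fun j => enum_rank (enum_val j)); split=> [j|j k ltjk].
  by rewrite fundamental_patternE fE mem_basis_hyperplane ?enum_valP // eqxx.
rewrite fundamental_patternE fE mem_basis_hyperplane ?enum_valP // negbK.
by rewrite (inj_eq enum_val_inj) neq_ltn ltjk orbT.
Qed.

(** Add the columns of a triangle from last to first. The hyperplane of row [i] contains every later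
    column, by the zeros above the diagonal, hence also their closure, but it misses column [i]; so
    each new column raises the rank. *)
Lemma tri_le_rk : (tri X <= r)%N.
Proof.
apply/bigmax_leqP => -[k /= _] /has_triangleP[f [g [d u]]].
pose tail l := [set enum_val (g i) | i : 'I_k & (k - l <= i)%N] : {set E}.
suff rk_tail l : (l <= k)%N -> (l <= rk M (tail l))%N.
  exact: leq_trans (rk_tail k (leqnn k)) (rkS M (subsetT _)).
elim: l => [//|l IHl] ltlk.
have lt_i : (k - l.+1 < k)%N by rewrite ltn_subrL (leq_trans _ ltlk).
(* Column [i] is the one that [tail l.+1] adds to [tail l], and the columns of [tail l] are exactly
   those after [i]. *)
pose i := Ordinal lt_i; have kl : (k - l = (k - l.+1).+1)%N by rewrite subnSK.
apply: leq_ltn_trans (IHl (ltnW ltlk)) _.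
have e_notin : enum_val (g i) \notin cl M (tail l).
  have := d i; rewrite mxE; apply/contra/subsetP/sub_hyperplane_cl.
    by have := enum_valP (f i); rewrite inE.
  apply/subsetP => _ /imsetP[j + ->]; rewrite inE kl => /(u i).
  by rewrite mxE negbK.
rewrite notin_clE in e_notin; apply: leq_trans e_notin (rkS M _).
rewrite subUset sub1set; apply/andP; split.
  by apply: imset_f; rewrite inE leqnn.
by apply: imsetS; apply/subsetP=> j; rewrite !inE kl => /ltnW.
Qed.

Lemma representable_rank_le (F : fieldType) : representable M F ->
  exists2 Q : 'M[F]_(#|hyperplanes M|, #|E|), in_Q X Q & (\rank Q <= r)%N.
Proof.
move=> [d [A indepE]]; pose v e := col (enum_rank e) A.
have span_cl I e : indep M I -> e \in cl M I -> v e \in <<[seq v x | x in I]>>%VS.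
  move=> iI; case: (boolP (e \in I)) => [eI _|eI]; first exact/memv_span/image_f.
  apply: contraLR => ve; rewrite notin_clE.
  have iIe : indep M (e |: I).
    by apply/indepE; rewrite (free_imageU1 v eI) ve; apply/indepE.
  by rewrite !rk_indep // cardsU1 eI.
have spanS S : forall I, I \subset S -> indep M I -> #|I| = rk M S ->
    (<<[seq v x | x in S]>> <= <<[seq v x | x in I]>>)%VS.
  move=> I sIS iI cI; apply/span_subvP => _ /imageP[e eS ->].
  exact/span_cl/(subsetP (sub_cl_maximal sIS iI cI)).
have [B [_ iB cB]] := rk_attained M [set: E].
have /boolp.choice[phi phiP] (i : 'I_#|hyperplanes M|) :
    exists phi : {scalar 'cV[F]_d},
      forall e, (phi (v e) != 0) = (e \notin (enum_val i : {set E})).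
  have := enum_valP i; rewrite inE; move: (enum_val i) => H hH.
  have /andP[/eqP clH /eqP rH] := hH.
  have [I [sIH iI cI]] := rk_attained M H.
  have off e : e \notin H -> [/\ e \notin I, indep M (e |: I) & #|e |: I| = r].
    move=> eH; have eI : e \notin I by apply: contra eH; apply: (subsetP sIH).
    split=> //; last by rewrite cardsU1 eI cI.
    apply: notin_cl_indep => //; apply: contra eH; apply: subsetP.
    exact: sub_hyperplane_cl.
  have [e0 e0H] : exists e, e \notin H.
    apply/existsP; apply: contraTT isT => /existsPn allH.
    have HT : H = [set: E] by apply/setP=> e; rewrite inE -[_ \in _]negbK allH.
    by move: (ltnn r); rewrite -[X in (_ < X)%N]rH HT ltnSn.
  have [e0I ie0 ce0] := off e0 e0H.
  have w0 : v e0 \notin <<[seq v x | x in H]>>%VS.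
    have : free [seq v x | x in e0 |: I] by apply/indepE.
    rewrite free_imageU1 // => /andP[+ _]; apply: contra.
    exact/subvP/spanS.
  have [phi [phi0 phiw]] := separating_form w0.
  exists phi => e; case: (boolP (e \in H)) => [eH|eH] /=.
    by apply/negbTE; rewrite negbK; apply/eqP/phi0/memv_span/image_f.
  (* If [phi] vanished at [v e], it would vanish on the basis [e |: I] of M, whose vectors span all
     the others, and so at [v e0]. *)
  have [eI ie ce] := off e eH; apply: contra phiw => /eqP phie.
  have /(subvP (spanS [set: E] _ (subsetT _) ie ce))/span_imageP[c ->] :
      v e0 \in <<[seq v x | x in [set: E]]>>%VS by apply/memv_span/image_f.
  rewrite linear_sum big1 //= => x xI; rewrite linearZ /=.
  suff -> : phi (v x) = 0 by rewrite mulr0.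
  case/setU1P: xI => [-> //|xI].
  by apply/phi0/memv_span/image_f/(subsetP sIH).
have /boolp.choice[c cP] (j : 'I_#|E|) : exists c : E -> F,
    v (enum_val j) = \sum_(b in B) c b *: v b.
  by apply/span_imageP/(subvP (spanS [set: E] _ _ iB cB))/memv_span/image_f.
exists (\matrix_(i, j) phi i (v (enum_val j))) => [i j|].
  by rewrite !mxE phiP.
rewrite -cB.
(* Expanding every vector over the basis [B] factors the matrix through dimension [#|B|]. *)
have -> : \matrix_(i, j) phi i (v (enum_val j)) =
    (\matrix_(i < #|hyperplanes M|, b < #|B|) phi i (v (enum_val b))) *m
    (\matrix_(b < #|B|, j < #|E|) c j (enum_val b)).
  apply/matrixP => i j; rewrite !mxE cP linear_sum [LHS]big_enum_val.
  by apply: eq_bigr => b _; rewrite !mxE linearZ /= mulrC.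
exact: mulmx_max_rank.
Qed.

Lemma rank_le_representable (F : fieldType)
    (Q : 'M[F]_(#|hyperplanes M|, #|E|)) :
  in_Q X Q -> (\rank Q <= r)%N -> representable M F.
Proof.
move=> QX rQ; exists _, Q => S; pose v e := col (enum_rank e) Q.
have Q0 i e : (Q i (enum_rank e) == 0) = (e \in (enum_val i : {set E})).
  by apply: negb_inj; rewrite -fundamental_patternE; apply/idP/idP => /QX.
(* The row of [basis_hyperplane M B b] vanishes at every element of [B] except [b], so it singles
   out the coefficient of [b]. *)
have coefE B b (i : 'I_#|hyperplanes M|) (c : E -> F) (K : {set E}) : indep M B -> #|B| = r -> b \in B ->
    enum_val i = basis_hyperplane M B b -> b \in K -> K \subset B ->
    (\sum_(x in K) c x *: v x) i 0 = c b * Q i (enum_rank b).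
  move=> iB cB bB iE bK sKB; rewrite summxE (bigD1 b) //= !mxE big1 ?addr0 //.
  move=> x /andP[xK xb]; rewrite !mxE; apply/eqP; rewrite mulf_eq0 Q0 iE.
  by rewrite mem_basis_hyperplane ?xb ?orbT // (subsetP sKB).
have Qb B b (i : 'I_#|hyperplanes M|) : indep M B -> #|B| = r -> b \in B ->
    enum_val i = basis_hyperplane M B b -> Q i (enum_rank b) != 0.
  by move=> iB cB bB iE; rewrite Q0 iE mem_basis_hyperplane // eqxx.
have free_indep K : indep M K -> free [seq v x | x in K].
  move=> iK; have [B [sKB _ iB cB]] := indep_extend iK (subsetT K).
  apply/free_imageP => c c0 b bK; have bB := subsetP sKB b bK.
  have [i iE] := basis_rows iB cB bB.
  have := coefE B b i c K iB cB bB iE bK sKB; rewrite c0 mxE => /esym/eqP.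
  by rewrite mulf_eq0 (negbTE (Qb B b i iB cB bB iE)) orbF => /eqP.
split=> [|fS]; first exact: free_indep.
(* Suppose [S] has an element [e] outside a maximum independent subset [I]. The rest of the proof
   puts [v e] in the span of the columns of [I], against the freeness of [S]. *)
have [I [sIS iI cI]] := rk_attained M S.
case: (boolP (S \subset I)) => [sSI|/subsetPn[e eS eI]].
  exact: indep_subset sSI iI.
have e_cl : e \in cl M I by apply: (subsetP (sub_cl_maximal sIS iI cI)).
have [B [sIB _ iB cB]] := indep_extend iI (subsetT I).
have ve : v e \in <<[seq v x | x in B]>>%VS.
  (* [U] is the column space of [Q]. Its dimension is at most [\rank Q], hence at most r, so the r
     free columns of [B] span it. *)
  pose L : 'Hom('cV[F]_(\rank Q), 'cV[F]__) := linfun (mulmx (col_base Q)).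
  pose U := limg L.
  have vU x : v x \in U.
    have -> : v x = L (col (enum_rank x) (row_base Q)).
      rewrite lfunE /= /v -{1}(mulmx_base Q); apply/colP=> i; rewrite !mxE.
      by apply: eq_bigr => j _; rewrite !mxE.
    exact: memv_img (memvf _).
  suff /eqP-> : <<[seq v x | x in B]>>%VS == U by [].
  rewrite eqEdim; apply/andP; split.
    by apply/span_subvP => _ /imageP[x _ ->].
  have /eqP-> := free_indep B iB.
  rewrite size_image cB; apply: leq_trans rQ.
  have := limg_ker_dim L fullv.
  by rewrite dimvf dim_matrix mulr1 => <-; apply: leq_addl.
have [c cE] := span_imageP ve.
(* For [b] outside [I], the hyperplane [cl M (B :\ b)] contains [cl M I] and so [e]; its row is
   therefore 0 at [e], which forces [c b = 0]. *)
have c0 b : b \in B :\: I -> c b = 0.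
  case/setDP=> bB bI; have [i iE] := basis_rows iB cB bB.
  have := coefE B b i c B iB cB bB iE bB (subxx B).
  have e0 : Q i (enum_rank e) = 0.
    apply/eqP; rewrite Q0 iE; apply: subsetP e_cl; apply: clS.
    by rewrite subsetD1 sIB.
  rewrite -cE mxE e0 => /esym/eqP.
  by rewrite mulf_eq0 (negbTE (Qb B b i iB cB bB iE)) orbF => /eqP.
have : free [seq v x | x in e |: I].
  by apply: free_imageS fS; rewrite subUset sub1set eS.
rewrite free_imageU1 // => /andP[/negP[]].
rewrite cE (big_setID I) /= (setIidPr sIB) [X in _ + X]big1 ?addr0.
  exact: sum_span_image.
by move=> b /c0->; rewrite scale0r.
Qed.

End FundamentalPattern.

(* Minimum rank against triangle number, both measured by the rank of M *)
From mathcomp Require Import classical_sets cardinality.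

Theorem theorem5p4 (F : fieldType) (hF : infinite_set [set: F]%classic)
    (E : finType) (M : matroid E) :
  representable M F <->
  mr F (fundamental_pattern M) = tri (fundamental_pattern M).
Proof.
have tri_rk : tri (fundamental_pattern M) = rk M finset.setT.
  by apply/eqP; rewrite eqn_leq tri_le_rk rk_le_tri.
split=> [/representable_rank_le[Q QX rQ]|mr_tri].
  apply/eqP; rewrite eqn_leq; apply/andP; split.
    by rewrite tri_rk; apply: leq_trans rQ; apply: mr_le_rank.
  by have [A AX <-] := mr_attained F (fundamental_pattern M); apply: tri_le_rank.
have [Q QX rQ] := mr_attained F (fundamental_pattern M).
by apply: (rank_le_representable QX); rewrite rQ mr_tri tri_rk.
Qed.
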